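(* Let $K\ge 2$ and $T\ge1$ be integers, $0<C_1<C_2$ constants, and let $\boldsymbol{r}^{(1)},\dots,\boldsymbol{r}^{(T)}\in[C_1,C_2]^K$ be the (fully observed) response vectors. Put $L_\infty=\frac{C_2}{1+C_1}$ and $\eta^{(t)}=\frac{L_\infty\sqrt{t}}{\sqrt{\log K}}$. Let $\boldsymbol{p}^{(1)}=\frac1K\boldsymbol{1}_K$ and, for $t\ge1$, $$\boldsymbol{p}^{(t+1)}=\operatorname*{arg\,min}_{\boldsymbol{p}\in\Delta_{K-1}}\ \sum_{\tau=1}^{t}\langle\boldsymbol{p},\boldsymbol{g}^{(\tau)}\rangle+\eta^{(t+1)}\sum_{i=1}^K p_i\log p_i,\qquad \boldsymbol{g}^{(\tau)}=\nabla\ell^{(\tau)}(\boldsymbol{p}^{(\tau)}).$$ Then $$\mathrm{Regret}^{(T)}(\boldsymbol{p}^\star)\le 2L_\infty\sqrt{T\log K}.$$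
   Context: $\Delta_{K-1}=\{\boldsymbol{q}\in\mathbb{R}^K: q_i\ge 0,\ \Vert\boldsymbol{q}\Vert_1=1\}$ is the probability simplex, with the convention $0\log 0=0$. The decision loss at round $t$ is $\ell^{(t)}(\boldsymbol{p})=-\log(1+\langle\boldsymbol{p},\boldsymbol{r}^{(t)}\rangle)$ for $\boldsymbol{p}\in\Delta_{K-1}$, where $\boldsymbol{r}^{(t)}$ is the response vector revealed at round $t$ after $\boldsymbol{p}^{(t)}$ is chosen; $\nabla\ell^{(t)}(\boldsymbol{p})=-\boldsymbol{r}^{(t)}/(1+\langle\boldsymbol{p},\boldsymbol{r}^{(t)}\rangle)$. The regret is $\mathrm{Regret}^{(T)}(\boldsymbol{p}^\star)=\sum_{t=1}^T\ell^{(t)}(\boldsymbol{p}^{(t)})-\sum_{t=1}^T\ell^{(t)}(\boldsymbol{p}^\star)$, where $\boldsymbol{p}^\star\in\operatorname{arg\,min}_{\boldsymbol{p}\in\Delta_{K-1}}\sum_{t=1}^T\ell^{(t)}(\boldsymbol{p})$. This update is the mixing-coefficient update of the federated learning algorithm AAggFF-D in the full-participation case (client sampling probability $C=1$), with $K$ clients and $T$ rounds. *)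

(* Defs.v *)
From mathcomp Require Export all_boot all_order all_algebra.
From mathcomp Require Export all_classical all_reals all_analysis.

Set Implicit Arguments.
Unset Strict Implicit.
Unset Printing Implicit Defensive.

Import Order.TTheory GRing.Theory Num.Theory.
Import numFieldNormedType.Exports.
Local Open Scope classical_set_scope.
Local Open Scope ring_scope.

Section Definitions.
Variables (R : realType) (K : nat).
Implicit Types (p q r g : 'rV[R]_K) (t T : nat).

Definition dotv p q : R := \sum_i p ord0 i * q ord0 i.

(* The library norm on 'rV[R]_K is the sup norm. *)
Definition norm1 q : R := \sum_i `|q ord0 i|.

Definition simplex : set 'rV[R]_K :=
  [set q : 'rV[R]_K | (forall i, 0 <= q ord0 i) /\ norm1 q = 1].

Definition argmin (A : set 'rV[R]_K) (f : 'rV[R]_K -> R) : set 'rV[R]_K :=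
  [set p : 'rV[R]_K | A p /\ forall q, A q -> f p <= f q].

Definition gradient (f : 'rV[R]_K -> R) p : 'rV[R]_K :=
  \row_i 'D_(delta_mx ord0 i) f p.

(* Given on all of 'rV[R]_K, so that partial derivatives at points of the
   simplex make sense; it is smooth wherever 1 + dotv p r > 0. *)
Definition loss r p : R := - ln (1 + dotv p r).

(* The convention 0 log 0 = 0 holds here: the factor p_i vanishes and ln is
   total. *)
Definition neg_entropy p : R := \sum_i p ord0 i * ln (p ord0 i).

Definition Linf (C1 C2 : R) : R := C2 / (1 + C1).

Definition eta (C1 C2 : R) t : R :=
  Linf C1 C2 * Num.sqrt t%:R / Num.sqrt (ln K%:R).

(* Rounds are numbered from 1; values at index 0 are never used. *)
Definition total_loss (r : nat -> 'rV[R]_K) T p : R :=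
  \sum_(1 <= t < T.+1) loss (r t) p.

Definition response_grad (r p : nat -> 'rV[R]_K) t : 'rV[R]_K :=
  gradient (loss (r t)) (p t).

(* Its minimizer is the decision of round t.+1, hence the weight eta at t.+1. *)
Definition ftrl_objective (C1 C2 : R) (r p : nat -> 'rV[R]_K) t
    (x : 'rV[R]_K) : R :=
  \sum_(1 <= tau < t.+1) dotv x (response_grad r p tau)
  + eta C1 C2 t.+1 * neg_entropy x.

Definition regret (r p : nat -> 'rV[R]_K) T pstar : R :=
  \sum_(1 <= t < T.+1) loss (r t) (p t) - total_loss r T pstar.

End Definitions.

Arguments simplex {R K}.

(* Main.v *)
(* By Gibbs' variational principle the round-t decision is the Gibbs distribution
   proportional to exp (- G_i / eta_t), with G = g_1 + ... + g_(t-1), and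
   Phi eta G := - eta ln (1/K sum_i exp (- G_i / eta)) is the minimum over the
   simplex of <q, G> + eta (H q + ln K), where H q = sum_i q_i ln q_i.
   Since H + ln K >= 0, Phi is nondecreasing in eta; and since the g_t lie in
   [-L, 0], Hoeffding's lemma (the constant 1/2 suffices) shows that adding g_t
   to G raises Phi by at least <p_t, g_t> - L^2 / (2 eta_t).  Telescoping, with
   Phi eta_T G <= <p*, G> + eta_T ln K at the end, bounds the linearised regret
   by eta_T ln K + sum_t L^2 / (2 eta_t); both terms are at most
   L sqrt (T ln K), because sum_(t <= T) 1 / sqrt t <= 2 sqrt T. *)
Require Import Defs.
From mathcomp Require Import ring lra.
Set Implicit Arguments.
Unset Strict Implicit.
Unset Printing Implicit Defensive.
Import Order.TTheory GRing.Theory Num.Theory.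
Import numFieldNormedType.Exports.
Local Open Scope classical_set_scope.
Local Open Scope ring_scope.

(** * Scalar inequalities: a Gaussian bound on cosh and a sum of inverse square roots *)

Section Cosh.
Variable R : realType.
Implicit Types x y : R.

Lemma ge0_is_derive_le (f df : R -> R) y :
  (forall x, is_derive x 1 f (df x)) -> (forall x, 0 < x -> 0 <= df x) ->
  0 <= y -> f 0 <= f y.
Proof.
move=> fd df0 y0; apply: (@ger0_derive1_ndecry R f 0) => //.
- by move=> x; rewrite in_itv/= andbT => x0; rewrite derive1E derive_val df0.
- apply: continuous_subspaceT => x.
  by apply/differentiable_continuous/derivable1_diffP/ex_derive.
Qed.

(** The difference of the two sides vanishes at 0 and has derivative [x * (expR x - expR (- x))],
    nonnegative for x > 0. *)
Lemma sinh_le_mul_cosh y : 0 <= y ->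
  expR y - expR (- y) <= y * (expR y + expR (- y)).
Proof.
move=> y0; rewrite -subr_ge0.
pose f (x : R) := x * (expR x + expR (- x)) - (expR x - expR (- x)).
have fd x : is_derive x 1 f (x * (expR x - expR (- x))).
  by rewrite /f; apply: is_derive_eq; rewrite /GRing.scale /=; ring.
have <- : f 0 = 0 by rewrite /f mul0r oppr0 !subrr.
apply: ge0_is_derive_le fd _ y0 => x x0.
by rewrite mulr_ge0 ?(ltW x0)// subr_ge0 ler_expR; lra.
Qed.

(** Both sides are even, and on y >= 0 the quotient cosh y / exp (y^2 / 2) decreases from 1:
    [sinh_le_mul_cosh] gives the sign of its derivative. *)
Lemma cosh_le_expR y : expR y + expR (- y) <= 2 * expR (y ^+ 2 / 2).
Proof.
wlog y0 : y / 0 <= y => [hw|].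
  have [/hw//|y0] := leP 0 y.
  by have := hw (- y); rewrite sqrrN opprK addrC; apply; lra.
pose f (x : R) := - ((expR x + expR (- x)) * expR (- (x * x / 2))).
have fd x : is_derive x 1 f
    ((x * (expR x + expR (- x)) - (expR x - expR (- x))) * expR (- (x * x / 2))).
  by rewrite /f; apply: is_derive_eq; rewrite /GRing.scale /=; field.
have : f 0 <= f y.
  apply: ge0_is_derive_le fd _ y0 => x x0.
  by rewrite mulr_ge0 ?expR_ge0// subr_ge0 sinh_le_mul_cosh ?ltW.
rewrite /f mul0r mul0r !oppr0 expR0 mulr1 lerN2 -expr2.
by rewrite [expR (- (_ / _))]expRN ler_pdivrMr ?expR_gt0.
Qed.

Lemma sum_invr_sqrt n : \sum_(1 <= t < n.+1) (Num.sqrt t%:R)^-1 <= 2 * Num.sqrt n%:R :> R.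
Proof.
elim: n => [|n IH]; first by rewrite big_nil mulr_ge0 ?sqrtr_ge0.
rewrite big_nat_recr//= (le_trans (lerD IH (lexx _)))//.
set a := Num.sqrt n%:R; set b := Num.sqrt n.+1%:R.
have a0 : 0 <= a by exact: sqrtr_ge0.
have b0 : 0 < b by rewrite sqrtr_gt0 ltr0n.
have a2 : a ^+ 2 = n%:R by rewrite sqr_sqrtr.
have b2 : b ^+ 2 = n%:R + 1 by rewrite sqr_sqrtr// -natr1.
(* Multiplied by b, the goal reads 2ab + 1 <= 2b^2, which is (b - a)^2 >= 0 because b^2 = a^2 +
   1. *)
rewrite -(ler_pM2r b0) mulrDl mulVf ?gt_eqF//.
nra.
Qed.

End Cosh.

(** * Exponential moments under a finite distribution *)

Section FiniteDistribution.
Variables (R : realType) (I : finType) (w : I -> R).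
Hypothesis w_ge0 : forall i, 0 <= w i.
Hypothesis w_sum1 : \sum_i w i = 1.

(** The tangent line of exp at the mean m lies below exp, and its average is exp m. *)
Lemma expR_jensen (x : I -> R) :
  expR (\sum_i w i * x i) <= \sum_i w i * expR (x i).
Proof.
set m := \sum_i _.
have -> : expR m = \sum_i w i * (expR m * (1 + (x i - m))).
  under eq_bigr do rewrite mulrCA mulrDr mulr1 mulrBr.
  by rewrite -mulr_sumr big_split/= sumrB -mulr_suml w_sum1 mul1r subrr addr0 mulr1.
apply: ler_sum => i _; apply: ler_wpM2l => //.
have -> : expR (x i) = expR m * expR (x i - m) by rewrite -expRD; congr expR; lra.
by rewrite ler_wpM2l ?expR_ge0// expR_ge1Dx.
Qed.

(* Symmetrisation: averaging over an independent copy x' of x replaces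
   exp (x - E x) by cosh (x - x'). *)
Lemma weak_hoeffding (x : I -> R) (c : R) : (forall i j, `|x i - x j| <= c) ->
  \sum_i w i * expR (x i) <= expR (\sum_i w i * x i + c ^+ 2 / 2).
Proof.
move=> xc; set m := \sum_i w i * x i.
rewrite expRD; set S := \sum_i _.
have S0 : 0 <= S by apply: sumr_ge0 => i _; rewrite mulr_ge0 ?expR_ge0.
rewrite -ler_pdivrMl ?expR_gt0// -expRN.
have : expR (- m) <= \sum_i w i * expR (- x i).
  rewrite /m -sumrN; under eq_bigr do rewrite -mulrN.
  exact: expR_jensen.
move=> /(ler_wpM2r S0)/le_trans; apply.
pose P := \sum_i \sum_j w i * w j * expR (x i - x j).
have PE : (\sum_i w i * expR (- x i)) * S = P.
  rewrite /P exchange_big/= mulr_suml; apply: eq_bigr => i _.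
  rewrite mulr_sumr; apply: eq_bigr => j _; rewrite expRD; ring.
have -> : expR (c ^+ 2 / 2) = \sum_i \sum_j w i * w j * expR (c ^+ 2 / 2).
  under eq_bigr do rewrite -mulr_suml -mulr_sumr w_sum1 mulr1.
  by rewrite -mulr_suml w_sum1 mul1r.
(* Doubling P and swapping the indices in one copy pairs exp (x_i - x_j) with exp (x_j - x_i), so
   that [cosh_le_expR] applies termwise. *)
rewrite PE -(@ler_pM2l _ 2)// [2 * P]mulr_natl mulr2n {2}/P exchange_big/=.
rewrite -big_split mulr_sumr; apply: ler_sum => i _.
rewrite -big_split mulr_sumr; apply: ler_sum => j _ /=.
rewrite [w j * w i]mulrC -mulrDr mulrCA ler_wpM2l ?mulr_ge0//.
rewrite -(opprB (x i)); apply: le_trans (cosh_le_expR _) _.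
rewrite ler_wpM2l// ler_expR ler_wpM2r ?invr_ge0//.
by rewrite -real_normK ?num_real// lerXn2r ?nnegrE// (le_trans (normr_ge0 _) (xc i j)).
Qed.

End FiniteDistribution.

(** * Relative entropy, Gibbs' variational principle and the potential *)

Section Gibbs.
Variable R : realType.
Implicit Types x w : R.

(** For x > 0 this is ln u <= u - 1 at u = w / x, strict unless u = 1. The equality case yields
    uniqueness of the minimizer in [argmin_softmin]. *)
Lemma relative_entropy_term_ge x w : 0 <= x -> 0 < w ->
  x - w <= x * (ln x - ln w) ?= iff (x == w).
Proof.
move=> x0 w0; apply/leifP; case: eqP => [->|/eqP xw]; first by rewrite !subrr mulr0.
move: x0; rewrite le_eqVlt => /predU1P[<-|x0]; first by rewrite mul0r sub0r oppr_lt0.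
rewrite -ltrN2 -mulrN !opprB -ln_div// -(ltr_pM2l (_ : 0 < x^-1)) ?invr_gt0//.
rewrite mulKf ?gt_eqF// mulrBr mulVf ?gt_eqF// ltrBrDl [x^-1 * w]mulrC.
rewrite -[ltRHS](@lnK _ (w / x)) ?posrE ?divr_gt0//.
apply: expR_gt1Dx; rewrite ln_eq0 ?divr_gt0//.
by rewrite -(inj_eq (mulIf (lt0r_neq0 x0))) divfK ?lt0r_neq0// mul1r eq_sym.
Qed.

Variable K : nat.
Hypothesis K_gt0 : (0 < K)%N.
Implicit Types (q g G : 'rV[R]_K) (e : R).

Lemma simplex_sum q : simplex q -> \sum_i q ord0 i = 1.
Proof. by case=> q0 <-; apply: eq_bigr => i _; rewrite ger0_norm. Qed.

Lemma dotvDr q g G : dotv q (g + G) = dotv q g + dotv q G.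
Proof. by rewrite -big_split; apply: eq_bigr => i _; rewrite mxE mulrDr. Qed.

Lemma dotv_sumr q (m n : nat) (g : nat -> 'rV[R]_K) :
  dotv q (\sum_(m <= t < n) g t) = \sum_(m <= t < n) dotv q (g t).
Proof.
apply: (big_morph (dotv q) (dotvDr q)).
by apply: big1 => i _; rewrite mxE mulr0.
Qed.

Definition partition_fun e G := \sum_i expR (- (G ord0 i / e)).

Definition softmin e G : 'rV[R]_K :=
  \row_i (expR (- (G ord0 i / e)) / partition_fun e G).

(* The minimum over the simplex of <q, G> + e (sum_i q_i ln q_i + ln K). *)
Definition potential e G := - (e * ln (partition_fun e G / K%:R)).

Lemma partition_fun_gt0 e G : 0 < partition_fun e G.
Proof.
apply: lt_le_trans (_ : expR (- (G ord0 (Ordinal K_gt0) / e)) <= _); first exact: expR_gt0.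
by rewrite /partition_fun (bigD1 (Ordinal K_gt0))//= lerDl sumr_ge0// => i _; exact: expR_ge0.
Qed.

Lemma softmin_gt0 e G i : 0 < softmin e G ord0 i.
Proof. by rewrite mxE divr_gt0 ?expR_gt0 ?partition_fun_gt0. Qed.

Lemma softmin_sum e G : \sum_i softmin e G ord0 i = 1.
Proof.
under eq_bigr do rewrite mxE.
by rewrite -mulr_suml divff// gt_eqF ?partition_fun_gt0.
Qed.

Lemma softmin_simplex e G : simplex (softmin e G).
Proof.
split=> [i|]; first exact/ltW/softmin_gt0.
rewrite -(softmin_sum e G); apply: eq_bigr => i _.
by rewrite gtr0_norm ?softmin_gt0.
Qed.

Lemma ln_softmin e G i :
  ln (softmin e G ord0 i) = - (G ord0 i / e) - ln (partition_fun e G).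
Proof. by rewrite mxE ln_div ?posrE ?expR_gt0 ?partition_fun_gt0// expRK. Qed.

(** The last sum is the relative entropy of q with respect to [softmin e G]: both the minimum and
    its uniqueness can be read off. *)
Lemma gibbs_identity e G q : e != 0 -> simplex q ->
  dotv q G + e * (neg_entropy q + ln K%:R) =
  potential e G + e * \sum_i q ord0 i * (ln (q ord0 i) - ln (softmin e G ord0 i)).
Proof.
move=> e0 /simplex_sum q1.
have -> : \sum_i q ord0 i * (ln (q ord0 i) - ln (softmin e G ord0 i)) =
    neg_entropy q + dotv q G / e + ln (partition_fun e G).
  rewrite -[ln (partition_fun e G)]mul1r -q1 !mulr_suml -!big_split/=.
  by apply: eq_bigr => i _; rewrite ln_softmin; ring.
rewrite /potential ln_div ?posrE ?partition_fun_gt0 ?ltr0n//.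
by field.
Qed.

Lemma potential_le e G q : 0 < e -> simplex q ->
  potential e G <= dotv q G + e * (neg_entropy q + ln K%:R).
Proof.
move=> e0 sq; rewrite gibbs_identity ?gt_eqF// lerDl mulr_ge0 ?(ltW e0)//.
rewrite [leLHS](_ : _ = \sum_i (q ord0 i - softmin e G ord0 i)); last first.
  by rewrite sumrB simplex_sum// softmin_sum subrr.
apply: ler_sum => i _; rewrite relative_entropy_term_ge ?softmin_gt0//.
exact: sq.1.
Qed.

Lemma potential_softmin e G : e != 0 ->
  dotv (softmin e G) G + e * (neg_entropy (softmin e G) + ln K%:R) = potential e G.
Proof.
move=> e0; rewrite gibbs_identity//; last exact: softmin_simplex.
by rewrite big1 ?mulr0 ?addr0// => i _; rewrite subrr mulr0.
Qed.

Lemma argmin_softmin e G q : 0 < e ->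
  argmin simplex (fun q => dotv q G + e * neg_entropy q) q -> q = softmin e G.
Proof.
move=> e0 [sq /(_ _ (softmin_simplex e G)) qmin].
have : dotv q G + e * (neg_entropy q + ln K%:R) <= potential e G.
  by have := potential_softmin G (lt0r_neq0 e0); lra.
rewrite gibbs_identity ?gt_eqF// gerDl pmulr_rle0// => kl0.
have term_ge i := relative_entropy_term_ge (sq.1 i) (softmin_gt0 e G i).
apply/rowP => i.
have sum0 : \sum_i (q ord0 i - softmin e G ord0 i) = 0.
  by rewrite sumrB simplex_sum// softmin_sum subrr.
(* The termwise bounds sum to 0 <= relative entropy; equality in the sum forces equality in every
   term. *)
have := leif_sum (fun i (_ : is_true true) => term_ge i).
rewrite sum0 => -[kl_ge0]; rewrite eq_le kl_ge0 kl0 => /esym/forallP/(_ i).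
by move=> /eqP.
Qed.

Lemma neg_entropy_le0 q : simplex q -> neg_entropy q <= 0.
Proof.
move=> sq; apply: sumr_le0 => i _; rewrite mulr_ge0_le0 ?ln_le0//; first exact: sq.1.
rewrite -(simplex_sum sq) (bigD1 i)//= lerDl sumr_ge0// => j _; exact: sq.1.
Qed.

Lemma partition_fun0 e : partition_fun e 0 = K%:R.
Proof.
rewrite /partition_fun; under eq_bigr do rewrite mxE mul0r oppr0 expR0.
by rewrite sumr_const card_ord.
Qed.

Lemma potential0 e : potential e 0 = 0.
Proof. by rewrite /potential partition_fun0 divff ?pnatr_eq0 -?lt0n// ln1 mulr0 oppr0. Qed.

Lemma softmin0 e : softmin e 0 = const_mx K%:R^-1.
Proof. by apply/rowP => i; rewrite !mxE partition_fun0 mul0r oppr0 expR0 mul1r. Qed.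

(** Gibbs' principle with G = 0 and weight 1, where the potential vanishes. *)
Lemma neg_entropy_ge q : simplex q -> 0 <= neg_entropy q + ln K%:R.
Proof.
move=> sq; have := potential_le 0 ltr01 sq; rewrite potential0 mul1r.
by rewrite [dotv q 0]big1 ?add0r// => i _; rewrite mxE mulr0.
Qed.

(** The minimizer for e' competes in the problem for e, where the nonnegative entropy term has the
    smaller weight. *)
Lemma potential_homo e e' G : 0 < e -> e <= e' -> potential e G <= potential e' G.
Proof.
move=> e0 ee'; rewrite -(potential_softmin G (_ : e' != 0)) ?gt_eqF ?(lt_le_trans e0)//.
apply: le_trans (potential_le G e0 (softmin_simplex e' G)) _.
by rewrite lerD2l ler_wpM2r ?neg_entropy_ge//; exact: softmin_simplex.
Qed.

(** The ratio of the partition functions at G + g and G is the mean of exp (- g_i / e) under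
    [softmin e G]; these exponents differ by at most c / e, so [weak_hoeffding] bounds it. *)
Lemma potential_step e G g (c : R) : 0 < e ->
  (forall i, - c <= g ord0 i <= 0) ->
  dotv (softmin e G) g - c ^+ 2 / (2 * e) <= potential e (G + g) - potential e G.
Proof.
move=> e0 gc; have Z0 := partition_fun_gt0.
have ZE : partition_fun e (G + g) =
    partition_fun e G * \sum_i softmin e G ord0 i * expR (- (g ord0 i / e)).
  rewrite mulr_sumr; apply: eq_bigr => i _.
  by rewrite !mxE mulrDl opprD expRD mulrA mulrCA divff ?mulr1 ?gt_eqF.
have xc i j : `|- (g ord0 i / e) - - (g ord0 j / e)| <= c / e.
  rewrite -opprD normrN -mulrBl normrM (gtr0_norm (_ : 0 < e^-1)) ?invr_gt0//.
  rewrite ler_pM2r ?invr_gt0// ler_norml.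
  by move: (gc i) (gc j) => /andP[? ?] /andP[? ?]; apply/andP; split; lra.
have := weak_hoeffding (fun i => ltW (softmin_gt0 e G i)) (softmin_sum e G) xc.
set S := \sum_i _ in ZE *; set m := \sum_i _ => Sle.
have S0 : 0 < S by rewrite -(pmulr_rgt0 _ (Z0 e G)) -ZE.
have {Sle} Sle : ln S <= m + (c / e) ^+ 2 / 2.
  by rewrite -[leRHS]expRK ler_ln ?posrE ?expR_gt0.
have mE : dotv (softmin e G) g = - (e * m).
  rewrite /m mulr_sumr -sumrN; apply: eq_bigr => i _.
  by field; rewrite gt_eqF.
have ZK0 : 0 < partition_fun e G / K%:R by rewrite divr_gt0 ?ltr0n.
rewrite /potential mE ZE [_ * S / _]mulrAC [ln (_ * S)]lnM ?posrE//.
have -> : c ^+ 2 / (2 * e) = e * ((c / e) ^+ 2 / 2) by field; rewrite gt_eqF.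
move: Sle; rewrite -(ler_pM2l e0); lra.
Qed.

(** * Gradient and convexity of the logarithmic loss *)

Lemma gradient_loss (r p : 'rV[R]_K) i : 0 < 1 + dotv p r ->
  gradient (loss r) p ord0 i = - (r ord0 i / (1 + dotv p r)).
Proof.
move=> a0; rewrite mxE; set a := 1 + dotv p r.
pose f (h : R) := - ln (a + h * r ord0 i).
have fE h : loss r (h *: delta_mx ord0 i + p) = f h.
  rewrite /loss /f /a -addrA; congr (- ln (1 + _)).
  rewrite /dotv; under eq_bigr do rewrite mxE mulrDl.
  rewrite big_split addrC; congr (_ + _) => /=.
  rewrite (bigD1 i)//= big1 ?addr0; first by rewrite !mxE !eqxx mulr1.
  by move=> j ji; rewrite !mxE (negbTE ji) andbF mulr0 mul0r.
have fd : is_derive (0 : R) 1 f (- (r ord0 i / a)).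
  have lnd : is_derive (a + 0 * r ord0 i : R) 1 (@ln R) (a + 0 * r ord0 i)^-1.
    by apply: is_derive1_ln; rewrite mul0r addr0.
  rewrite /f; apply: is_derive_eq; rewrite /GRing.scale/= mul0r !addr0; ring.
transitivity ('D_1 f 0); last exact: derive_val.
(* The partial derivative and the derivative of f at 0 are limits of the same difference
   quotient. *)
rewrite /derive; congr (lim _); apply: (congr1 (fun F : R -> R => F @ 0^')).
have f0 : loss r p = f 0 by rewrite -fE scale0r add0r.
by apply/funext => h /=; rewrite fE f0 addr0 [h *: 1]mulr1.
Qed.

(** With u = (1 + <q, r>) / (1 + <p, r>), the left side is ln u and the right side is u - 1. *)
Lemma loss_sub_le (r p q : 'rV[R]_K) : 0 < 1 + dotv p r -> 0 < 1 + dotv q r ->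
  loss r p - loss r q <=
  dotv p (gradient (loss r) p) - dotv q (gradient (loss r) p).
Proof.
move=> p0 q0.
have dotvE s : dotv s (gradient (loss r) p) = - (dotv s r / (1 + dotv p r)).
  rewrite /dotv mulr_suml -sumrN; apply: eq_bigr => i _.
  by rewrite gradient_loss// mulrN mulrA.
rewrite !dotvE /loss opprK addrC -ln_div//.
apply: (@le_trans _ _ ((1 + dotv q r) / (1 + dotv p r) - 1)).
  have -> : (1 + dotv q r) / (1 + dotv p r) = 1 + ((1 + dotv q r) / (1 + dotv p r) - 1) by lra.
  rewrite (le_trans (le_ln1Dx _))// ?ltrBrDl ?subrr ?divr_gt0//; lra.
by rewrite le_eqVlt; apply/orP; left; apply/eqP; field; rewrite gt_eqF.
Qed.

End Gibbs.

(** * Bounds on the gradients and monotonicity of the weights *)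

Section Decisions.
Variables (R : realType) (K : nat) (C1 C2 : R).
Hypotheses (C1_gt0 : 0 < C1) (C1_lt_C2 : C1 < C2).
Implicit Types q r : 'rV[R]_K.

Lemma Linf_gt0 : 0 < Linf C1 C2.
Proof. by rewrite divr_gt0 ?addr_gt0// (lt_trans C1_gt0). Qed.

Lemma dotv_ge q r : simplex q -> (forall i, C1 <= r ord0 i <= C2) -> C1 <= dotv q r.
Proof.
move=> sq rC; rewrite -[C1]mul1r -(simplex_sum sq) mulr_suml.
by apply: ler_sum => i _; rewrite ler_wpM2l//; [exact: sq.1|case/andP: (rC i)].
Qed.

(** The entry is - r_i / (1 + <q, r>), with r_i <= C2 and <q, r> >= C1. *)
Lemma gradient_loss_bounds q r i : simplex q -> (forall i, C1 <= r ord0 i <= C2) ->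
  - Linf C1 C2 <= gradient (loss r) q ord0 i <= 0.
Proof.
have C1_pos := C1_gt0.
move=> sq rC; have qr := dotv_ge sq rC; have /andP[r1 r2] := rC i.
rewrite gradient_loss ?lerN2 ?oppr_le0; last by lra.
apply/andP; split; last by rewrite divr_ge0//; lra.
rewrite /Linf; apply: ler_pM => //; first by lra.
  by rewrite invr_ge0; lra.
by rewrite lef_pV2 ?posrE; lra.
Qed.

Lemma ln_natr_gt0 : (1 < K)%N -> 0 < ln K%:R :> R.
Proof. by move=> K1; rewrite ln_gt0// ltr1n. Qed.

Lemma eta_gt0 t : (1 < K)%N -> (0 < t)%N -> 0 < eta K C1 C2 t.
Proof.
move=> K1 t0; apply: divr_gt0; last by rewrite sqrtr_gt0 ln_natr_gt0.
by apply: mulr_gt0; [exact: Linf_gt0|rewrite sqrtr_gt0 ltr0n].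
Qed.

Lemma eta_homo t : eta K C1 C2 t <= eta K C1 C2 t.+1.
Proof.
rewrite /eta ler_wpM2r ?invr_ge0 ?sqrtr_ge0// ler_wpM2l ?(ltW Linf_gt0)//.
by rewrite ler_wsqrtr// ler_nat.
Qed.

End Decisions.

(** * Telescoping and the final regret bound *)

Theorem theorem5p2 (R : realType) (K T : nat) (C1 C2 : R)
    (r p : nat -> 'rV[R]_K) (pstar : 'rV[R]_K) :
  (2 <= K)%N -> (1 <= T)%N ->
  0 < C1 -> C1 < C2 ->
  (forall t : nat, (1 <= t <= T)%N ->
     forall i : 'I_K, C1 <= r t ord0 i <= C2) ->
  p 1%N = const_mx (K%:R^-1) ->
  (forall t : nat, (1 <= t < T)%N ->
     argmin simplex (ftrl_objective C1 C2 r p t) (p t.+1)) ->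
  argmin simplex (total_loss r T) pstar ->
  regret r p T pstar <= 2 * Linf C1 C2 * Num.sqrt (T%:R * ln K%:R).
Proof.
move=> K1 T1 C10 C12 rC p1 pmin [sstar _].
have K0 : (0 < K)%N by exact: ltn_trans K1.
have L0 := Linf_gt0 C10 C12; set L := Linf C1 C2 in L0 *.
pose e t := @eta R K C1 C2 t; pose g := response_grad r p.
have e0 t : (0 < t)%N -> 0 < e t by exact: eta_gt0.
pose G t := \sum_(1 <= s < t) g s.
have GS t : (0 < t)%N -> G t.+1 = G t + g t by move=> t0; rewrite /G big_nat_recr.
(* [G t] stops before round t. At t = 1 it is the empty sum, whose Gibbs distribution is the uniform
   starting point. *)
have pE t : (1 <= t <= T)%N -> p t = softmin (e t) (G t).
  case: t => [//|[_|t /andP[_ tT]]]; first by rewrite /G big_geq// softmin0.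
  apply: argmin_softmin => //; first exact: e0.
  have [sp pm] := pmin t.+1 tT; split=> // q sq.
  by rewrite /G !dotv_sumr; exact: pm.
have sp t : (1 <= t <= T)%N -> simplex (p t).
  by move=> tT; rewrite pE//; exact: softmin_simplex.
pose h t := dotv (p t) (g t) - L ^+ 2 / (2 * e t).
have hstep t : (1 <= t <= T)%N ->
    h t <= potential (e t) (G t.+1) - potential (e t) (G t).
  move=> tT; have t0 : (0 < t)%N by case/andP: tT.
  rewrite /h {1}pE// GS//; apply: potential_step => //; first exact: e0.
  by move=> i; apply: gradient_loss_bounds => //; [exact: sp|exact: rC].
have hsum n : (n < T)%N -> \sum_(1 <= t < n.+1) h t <= potential (e n.+1) (G n.+1).
  elim: n => [_|n IH nT]; first by rewrite /G !big_geq// potential0.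
  rewrite big_nat_recr//=.
  apply: le_trans (potential_homo K0 (G n.+2) (e0 n.+1 _) (eta_homo K C10 C12 n.+1)) => //.
  by have := IH (ltnW nT); have := hstep n.+1 (ltnW nT); lra.
(* The last round is added without a further increase of the weight, so the bound ends with [e T]
   rather than [e T.+1]. *)
have hT : \sum_(1 <= t < T.+1) h t <= potential (e T) (G T.+1).
  have [n Tn] : exists n, T = n.+1 by exists T.-1; rewrite prednK.
  rewrite Tn in hstep hsum *; rewrite big_nat_recr//=.
  by have := hsum n (leqnn _); have := hstep n.+1 (leqnn _); lra.
have potle := potential_le K0 (G T.+1) (e0 T T1) sstar.
(* Convexity of each loss reduces the regret to its linearisation. *)
have regle : regret r p T pstar <=
    \sum_(1 <= t < T.+1) dotv (p t) (g t) - dotv pstar (G T.+1).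
  rewrite /regret /total_loss -sumrB /G dotv_sumr -sumrB.
  rewrite big_nat [leRHS]big_nat; apply: ler_sum => t; rewrite ltnS => tT.
  have := dotv_ge (sp t tT) (rC t tT); have := dotv_ge sstar (rC t tT) => q1 q2.
  by apply: loss_sub_le => //; lra.
pose s := Num.sqrt (ln K%:R) : R.
have s0 : 0 < s by rewrite sqrtr_gt0 ln_natr_gt0.
have s2 : ln K%:R = s ^+ 2 by rewrite sqr_sqrtr// ltW// ln_natr_gt0.
(* Since e_t = L sqrt t / s, each penalty L^2 / (2 e_t) equals L s / (2 sqrt t). *)
have penE : \sum_(1 <= t < T.+1) h t = \sum_(1 <= t < T.+1) dotv (p t) (g t)
    - L * s / 2 * \sum_(1 <= t < T.+1) (Num.sqrt t%:R)^-1.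
  rewrite mulr_sumr -sumrB big_nat [RHS]big_nat; apply: eq_bigr => t /andP[t0 _].
  rewrite /h /e /eta -/s -/L; congr (_ - _); field.
  by rewrite (gt_eqF s0) (gt_eqF L0) gt_eqF ?sqrtr_gt0 ?ltr0n.
(* The entropy sum is at most 0, and e_T ln K = L sqrt T s because ln K = s^2. *)
have eT : e T * (neg_entropy pstar + ln K%:R) <= L * Num.sqrt T%:R * s.
  apply: (@le_trans _ _ (e T * ln K%:R)).
    by rewrite ler_pM2l ?e0// gerDr neg_entropy_le0.
  by rewrite s2 /e /eta -/s -/L le_eqVlt; apply/orP; left; apply/eqP; field; rewrite gt_eqF.
have pen : L * s / 2 * \sum_(1 <= t < T.+1) (Num.sqrt t%:R)^-1 <= L * s * Num.sqrt T%:R.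
  have -> : L * s * Num.sqrt T%:R = L * s / 2 * (2 * Num.sqrt T%:R) by field.
  by rewrite ler_wpM2l ?sum_invr_sqrt// divr_ge0// mulr_ge0// ltW.
rewrite sqrtrM ?ler0n// -/s.
have -> : 2 * L * (Num.sqrt T%:R * s) = L * Num.sqrt T%:R * s + L * s * Num.sqrt T%:R by ring.
by move: hT; rewrite penE; lra.
Qed.
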